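(* Let $0<\delta<1/8$ and let $G=(V,E)$ be a $\delta$-good expander on $n$ vertices. Then there is a deterministic identification procedure for $G$ (that is, a map taking each report profile $r$ on $G$ to a pair of disjoint sets $T'=T'(r)$, $B'=B'(r)\subseteq V$) such that for every partition $V=T\cup B$, $T\cap B=\emptyset$, with $|T|>|B|$, and every report profile $r$ consistent with $(T,B)$, we have $T'(r)\subseteq T$, $B'(r)\subseteq B$ and $|T'(r)\cup B'(r)|>(1-\delta)n$. That is, from the reports one can recover the type of almost all vertices of $G$. Moreover, if $|T|>(1/2+\delta)n$, then there is an algorithm running in time linear in the size of $G$ which, given $G$ and a report profile consistent with $(T,B)$, outputs sets $T'\subseteq T$ and $B'\subseteq B$ with $|T'\cup B'|>(1-\delta)n$.
   Context: Corruption detection model (undirected case). $G=(V,E)$ is a finite undirected graph. Its vertex set is partitioned as $V=T\cup B$, $T\cap B=\emptyset$: vertices in $T$ are called truthful and vertices in $B$ corrupt. Every vertex $u$ reports on each of its neighbors $v$ whether $v$ is truthful or corrupt. A report profile is a function $r$ assigning to every ordered pair $(u,v)$ with $\{u,v\}\in E$ a value $r(u,v)\in\{\text{truthful},\text{corrupt}\}$, interpreted as $u$'s report about $v$. A report profile $r$ is consistent with the partition $(T,B)$ if for every $u\in T$ and every neighbor $v$ of $u$, $r(u,v)$ equals the true type of $v$. There is no constraint on reports made by corrupt vertices: they may be arbitrary and coordinated. For $0<\delta<1/8$, a graph $G=(V,E)$ on $n$ vertices is a $\delta$-good expander if (1) every set $U\subseteq V$ with $|U|\le 2\delta n$ has more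 than $|U|$ neighbors outside $U$, and (2) for any two sets of vertices $A,C$ with $|A|\ge \delta n$ and $|C|\ge n/4$ there is an edge of $G$ with one endpoint in $A$ and the other in $C$. *)

(* Defs.v *)
From HB Require Import structures.
From mathcomp Require Import all_boot all_order all_algebra.

Set Implicit Arguments.
Unset Strict Implicit.
Unset Printing Implicit Defensive.

Import Order.TTheory GRing.Theory Num.Theory.

Record sgraph (V : finType) := SGraph {
  adjacent :> rel V;
  adjacent_sym : symmetric adjacent;
  adjacent_irrefl : irreflexive adjacent }.

Section Graphs.
Variables (V : finType) (G : sgraph V).

Definition edges : {set {set V}} :=
  [set [set p.1; p.2] | p : V * V & G p.1 p.2].

Definition graph_size : nat := #|V| + #|edges|.

Definition outer_nbrs (U : {set V}) : {set V} :=
  [set v | (v \notin U) && [exists u in U, G u v]].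

Definition nbr (u : V) : Type := {v : V | G u v}.

End Graphs.

Local Open Scope ring_scope.

(* The expansion condition is required of nonempty sets only: the empty set
   has no neighbors, so with U = set0 allowed no graph would qualify.
   In the second condition A and C need not be disjoint. *)
Definition good_expander (R : realFieldType) (delta : R)
    (V : finType) (G : sgraph V) : Prop :=
  (forall U : {set V}, U != set0 -> #|U|%:R <= 2 * delta * #|V|%:R ->
     (#|U| < #|outer_nbrs G U|)%N)
  /\ (forall A C : {set V},
     delta * #|V|%:R <= #|A|%:R -> #|V|%:R / 4 <= #|C|%:R :> R ->
     exists a c : V, [/\ a \in A, c \in C & G a c]).

Local Close Scope ring_scope.

Inductive status := Truthful | Corrupt.

Definition report_profile (V : finType) (G : sgraph V) : Type :=
  forall u : V, nbr G u -> status.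

Definition bipartition (V : finType) (T B : {set V}) : Prop :=
  T :|: B = [set: V] /\ T :&: B = set0.

Definition consistent (V : finType) (G : sgraph V)
    (r : report_profile G) (T B : {set V}) : Prop :=
  forall u, u \in T -> forall v : nbr G u,
    (sval v \in T -> r u v = Truthful) /\ (sval v \in B -> r u v = Corrupt).

(* Machine model: a unit-cost successor RAM, as structured programs over
   integer arrays.  [m a i] is cell i of array a; only finitely many arrays
   occur in a given program, and scalar variables are cells at index 0.  The
   only arithmetic is +1 and -1, so in t steps no number exceeds the largest
   number of the input and the program by more than t: every unit-cost step
   acts on words of logarithmic length. *)
Definition memory := nat -> nat -> nat.

Inductive expr :=
| Lit of nat
| Cell of nat & expr
| Succ of expr
| Pred of expr.

Inductive test :=
| Eq of expr & expr
| Lt of expr & expr.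

Inductive cmd :=
| Skip
| Store of nat & expr & expr
| Seq of cmd & cmd
| If of test & cmd & cmd
| While of test & cmd.

Fixpoint eval (m : memory) (e : expr) : nat :=
  match e with
  | Lit k => k
  | Cell a i => m a (eval m i)
  | Succ e => (eval m e).+1
  | Pred e => (eval m e).-1
  end.

Definition holds (m : memory) (b : test) : bool :=
  match b with
  | Eq e1 e2 => eval m e1 == eval m e2
  | Lt e1 e2 => eval m e1 < eval m e2
  end.

Fixpoint expr_cost (e : expr) : nat :=
  match e with
  | Lit _ => 1
  | Cell _ e | Succ e | Pred e => (expr_cost e).+1
  end.

Definition test_cost (b : test) : nat :=
  match b with Eq e1 e2 | Lt e1 e2 => (expr_cost e1 + expr_cost e2).+1 end.

Definition update (m : memory) (a i x : nat) : memory :=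
  fun a' i' => if (a' == a) && (i' == i) then x else m a' i'.

(* [exec c m t m']: started in memory m, program c halts after exactly t
   elementary steps, in memory m'. *)
Inductive exec : cmd -> memory -> nat -> memory -> Prop :=
| exec_skip m : exec Skip m 1 m
| exec_store a i e m :
    exec (Store a i e) m (expr_cost i + expr_cost e).+1
      (update m a (eval m i) (eval m e))
| exec_seq c1 c2 m1 m2 m3 t1 t2 :
    exec c1 m1 t1 m2 -> exec c2 m2 t2 m3 -> exec (Seq c1 c2) m1 (t1 + t2) m3
| exec_if b c1 c2 m m' t :
    exec (if holds m b then c1 else c2) m t m' ->
    exec (If b c1 c2) m (test_cost b + t) m'
| exec_while_stop b c m :
    ~~ holds m b -> exec (While b c) m (test_cost b) m
| exec_while_step b c m1 m2 m3 t1 t2 :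
    holds m1 b -> exec c m1 t1 m2 -> exec (While b c) m2 t2 m3 ->
    exec (While b c) m1 (test_cost b + t1 + t2) m3.

Lemma exec_det c m t1 m1 t2 m2 :
  exec c m t1 m1 -> exec c m t2 m2 -> t1 = t2 /\ m1 = m2.
Proof.
move=> H; elim: H t2 m2 => {c m t1 m1}.
- by move=> m t2 m2 H; inversion H.
- by move=> a i e m t2 m2 H; inversion H.
- move=> c1 c2 m1 m2 m3 t1 t2 _ IH1 _ IH2 t m H.
  inversion H as [| |? ? ? m2' ? t1' t2' E1 E2| | |]; subst.
  have [-> E] := IH1 _ _ E1; rewrite -E in E2.
  by have [-> ->] := IH2 _ _ E2.
- move=> b c1 c2 m m' t _ IH t2 m2 H.
  inversion H as [| | |? ? ? ? ? t' E| |]; subst.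
  by have [-> ->] := IH _ _ E.
- move=> b c m /negbTE Hb t2 m2 H.
  inversion H as [| | | | |? ? ? ? ? ? ? Hb']; subst => //.
  by rewrite Hb in Hb'.
- move=> b c m1 m2 m3 t1 t2 Hb _ IH1 _ IH2 t m H.
  inversion H as [| | | |? ? ? Hb'|? ? ? m2' ? t1' t2' Hb' E1 E2]; subst.
    by rewrite Hb in Hb'.
  have [-> E] := IH1 _ _ E1; rewrite -E in E2.
  by have [-> ->] := IH2 _ _ E2.
Qed.

(* The vertices are numbered 0, ..., #|V|-1 by [enum_rank]; the order of each
   adjacency list is arbitrary. *)
Definition adjacency_lists (V : finType) (G : sgraph V)
    (adj : forall u : V, seq (nbr G u)) : Prop :=
  forall u, uniq (adj u) /\ forall v : nbr G u, v \in adj u.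

Definition status_code (x : status) : nat :=
  match x with Truthful => 1 | Corrupt => 2 end.

Definition memory_of (arrays : seq (seq nat)) : memory :=
  fun a i => nth 0 (nth [::] arrays a) i.

(* Array 0 holds the number of vertices.  The adjacency lists are concatenated
   in array 2, the list of vertex i occupying the positions k with
   off i <= k < off i.+1, where off is array 1; array 3 holds at position k the
   report of i on the neighbor listed at position k.  All else is 0. *)
Definition input (V : finType) (G : sgraph V) (r : report_profile G)
    (adj : forall u : V, seq (nbr G u)) : memory :=
  memory_of
    [:: [:: #|V|];
        [seq sumn (take i [seq size (adj u) | u <- enum V])
           | i <- iota 0 #|V|.+1];
        [seq enum_rank (sval v) : nat | u <- enum V, v <- adj u];
        [seq status_code (r u v) | u <- enum V, v <- adj u]].

(* The output is read off array 4. *)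
Definition output (V : finType) (m : memory) (x : status) : {set V} :=
  [set v : V | m 4 (enum_rank v) == status_code x].

(* Main.v *)
Require Import Defs.
From HB Require Import structures.
From mathcomp Require Import all_boot all_order all_algebra.
From mathcomp Require Import zify lra.

Set Implicit Arguments.
Unset Strict Implicit.
Unset Printing Implicit Defensive.

Import Order.TTheory GRing.Theory Num.Theory.

(** Every set of n/4 vertices is adjacent to all but fewer than delta n vertices, so
    a union of components of G[T] has fewer than delta n vertices or misses fewer
    than delta n vertices of T.  Hence a majority set T contains a component K of
    G[T] missing fewer than delta n vertices of T, and K together with its outer
    neighbors (all corrupt) covers more than (1 - delta) n vertices.  So it is
    enough to find K.

    If T1 and T2 are majority sets consistent with the same reports, no edge leaves
    the intersection W of T1 and T2 towards exactly one of them.  If T2 missed the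
    giant component of T1, then W would have fewer than delta n vertices, and all
    its outer neighbors outside the union of T1 and T2, a set of fewer than |W|
    vertices; this contradicts expansion.  So T2 meets the giant component of T1,
    which is then a component of T2 as well: the reports determine K.

    For the linear-time algorithm, K has more than n/2 vertices, is strongly
    connected under "u reports v truthful", and no such arc leaves K.  Hence a
    depth-first search of all the vertices visits K without interruption once it
    has entered it, and the vertex visited in the middle belongs to K.  A second
    search, from that vertex, visits exactly K. *)

(** * Components of an induced subgraph *)

Lemma closed_setU (V : finType) (e : rel V) (S1 S2 : {set V}) :
  closed e S1 -> closed e S2 -> closed e (S1 :|: S2).
Proof. by move=> cl1 cl2 u v uv; rewrite !inE (cl1 u v) // (cl2 u v). Qed.

Lemma closed_setD (V : finType) (e : rel V) (S1 S2 : {set V}) :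
  closed e S1 -> closed e S2 -> closed e (S1 :\: S2).
Proof. by move=> cl1 cl2 u v uv; rewrite !inE (cl1 u v) // (cl2 u v). Qed.

Section Components.
Variables (V : finType) (G : sgraph V).
Implicit Types (S T : {set V}) (u v x y : V).

Definition inner_edge T : rel V := [rel u v | [&& G u v, u \in T & v \in T]].

Definition component T x : {set V} := [set v | connect (inner_edge T) x v].

Definition majority S : bool := #|V| < 2 * #|S|.

Definition large S : bool := #|V| <= 4 * #|S|.

(* Two sets consistent with the same reports satisfy this, as the reports of u
   determine which neighbors of u belong to each of them. *)
Definition agree T1 T2 : Prop :=
  forall u v, u \in T1 -> u \in T2 -> G u v -> (v \in T1) = (v \in T2).

Lemma agree_sym T1 T2 : agree T1 T2 -> agree T2 T1.
Proof. by move=> agr u v u2 u1 /(agr _ _ u1 u2) ->. Qed.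

Lemma connect_inner_edgeC T : connect_sym (inner_edge T).
Proof.
apply: sym_connect_sym => u v; rewrite /inner_edge /= adjacent_sym; congr (_ && _).
exact: andbC.
Qed.

Lemma closed_inner_edge T : closed (inner_edge T) T.
Proof. by move=> u v /and3P[_ -> ->]. Qed.

Lemma mem_component T x : x \in component T x.
Proof. by rewrite inE connect0. Qed.

Lemma component_closed T x : closed (inner_edge T) (component T x).
Proof.
by move=> u v uv; rewrite !inE; apply: (connect_closed (connect_inner_edgeC T)).
Qed.

Lemma component_min T S x :
  closed (inner_edge T) S -> x \in S -> component T x \subset S.
Proof.
by move=> clS xS; apply/subsetP => v; rewrite inE => /(closed_connect clS) <-.
Qed.

Lemma component_sub T x : x \in T -> component T x \subset T.
Proof. exact/component_min/closed_inner_edge. Qed.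

Lemma component_eq T x y : y \in component T x -> component T y = component T x.
Proof.
rewrite inE => xy; apply/setP => v; rewrite !inE.
by rewrite (same_connect (connect_inner_edgeC T) xy).
Qed.

Lemma agree_component_eq T1 T2 x :
  agree T1 T2 -> x \in T1 -> x \in T2 -> component T1 x = component T2 x.
Proof.
have sub S1 S2 : agree S1 S2 -> x \in S2 -> component S1 x \subset component S2 x.
  move=> agr x2; apply: component_min (mem_component _ _) => a b.
  apply: (intro_closed (connect_inner_edgeC S1)) => u v /and3P[uv u1 v1] uK.
  have u2 := subsetP (component_sub x2) u uK.
  have uv2 : inner_edge S2 u v by rewrite /inner_edge /= uv u2 -(agr u v u1 u2 uv).
  by rewrite -(component_closed x uv2).
by move=> agr x1 x2; apply/eqP; rewrite eqEsubset !sub //; apply: agree_sym.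
Qed.

Lemma outer_nbrs_closed T S :
  S \subset T -> closed (inner_edge T) S -> outer_nbrs G S \subset ~: T.
Proof.
move=> /subsetP ST clS; apply/subsetP => v; rewrite !inE.
move=> /andP[vS /exists_inP[u uS uv]]; apply: contra vS => vT.
by rewrite -(clS u v) // /inner_edge /= uv vT ST.
Qed.

Lemma majority_large S : majority S -> large S.
Proof. by rewrite /majority /large; lia. Qed.

Lemma disjoint_outer_nbrs S : S :&: outer_nbrs G S = set0.
Proof. by apply/setP => v; rewrite !inE; case: (v \in S). Qed.

Lemma bipartition_setC T B : bipartition T B -> B = ~: T.
Proof.
case=> TUB TIB; apply/setP => v; move/setP/(_ v): TUB; move/setP/(_ v): TIB.
by rewrite !inE; case: (v \in T); case: (v \in B).
Qed.

Lemma bipartition_majority T B : bipartition T B -> majority T = (#|B| < #|T|).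
Proof. by move/bipartition_setC=> ->; have := cardsC T; rewrite /majority; lia. Qed.

Lemma leq_adjacent_pairs : \sum_(p : V * V | G p.1 p.2) 1 <= 2 * #|edges G|.
Proof.
rewrite (partition_big (fun p => [set p.1; p.2]) [in edges G]) /=.
  rewrite mulnC -sum_nat_const; apply: leq_sum => e /imsetP[[a b] _ ->].
  rewrite sum1_card; apply: (@leq_trans #|[set (a, b); (b, a)]|).
    apply: subset_leq_card; apply/subsetP => -[c d]; rewrite !inE /=.
    move=> /andP[_ /eqP cd].
    have := set21 a b; have := set22 a b; have := set21 c d; have := set22 c d.
    rewrite {1 2}cd -{3 4}cd !inE !xpair_eqE.
    by do 4!case/orP=> /eqP ->; rewrite ?eqxx ?orbT.
  by rewrite cards2; case: (_ != _).
by move=> p Gp; apply/imsetP; exists p; rewrite ?inE.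
Qed.

End Components.

Local Open Scope ring_scope.

(** * The giant component *)

Section Expander.
Variables (R : realFieldType) (delta : R) (V : finType) (G : sgraph V).
Implicit Types (S T : {set V}) (x y : V).

Let n : R := #|V|%:R.

Definition small S : bool := #|S|%:R < delta * n.

Lemma majorityE S : majority S = (n / 2 < #|S|%:R).
Proof. by rewrite /majority -(ltr_nat R) natrM -/n; apply/idP/idP; lra. Qed.

Lemma largeE S : large S = (n / 4 <= #|S|%:R).
Proof. by rewrite /large -(ler_nat R) natrM -/n; apply/idP/idP; lra. Qed.

Lemma natr_cardsDS T S : S \subset T -> #|T :\: S|%:R = #|T|%:R - #|S|%:R :> R.
Proof. by move=> ST; rewrite cardsDS // natrB // subset_leq_card. Qed.

Lemma sub_small S T : S \subset T -> small T -> small S.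
Proof. by move=> ST; apply: le_lt_trans; rewrite ler_nat subset_leq_card. Qed.

Hypotheses (delta_gt0 : 0 < delta) (delta_lt : delta < 1 / 8).
Hypothesis expG : good_expander delta G.

Let delta_n_ge0 : 0 <= delta * n.
Proof. by rewrite mulr_ge0 ?ler0n // ltW. Qed.

Let delta_n_le : delta * n <= n / 8.
Proof. by have := ler_wpM2r (ler0n R #|V|) (ltW delta_lt); rewrite -/n; lra. Qed.

Lemma small_nonneighbors S : large S -> small (~: (S :|: outer_nbrs G S)).
Proof.
rewrite largeE => bigS; rewrite /small ltNge; apply/negP => big.
have [a [c [aN cS ac]]] := expG.2 _ S big bigS.
move: aN; rewrite !inE; case: (a \in S) => //= /exists_inP[].
by exists c => //; rewrite adjacent_sym.
Qed.

Lemma small_closed_compl T S :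
  S \subset T -> closed (inner_edge G T) S -> large S -> small (T :\: S).
Proof.
move=> ST clS bigS; apply: sub_small (small_nonneighbors bigS).
by rewrite setDE setCU setIC setIS // -[T]setCK setCS outer_nbrs_closed.
Qed.

Lemma closed_small_or_cosmall T S :
  majority T -> S \subset T -> closed (inner_edge G T) S ->
  small S || small (T :\: S).
Proof.
move=> majT ST clS; apply/orP.
have [bigS | smallS] := boolP (large S); [right | left].
  exact: small_closed_compl.
have := @small_closed_compl T (T :\: S) (subsetDl _ _).
rewrite setDDr setDv set0U (setIidPr ST); apply.
  by apply: closed_setD => //; apply: closed_inner_edge.
by move: majT smallS; rewrite majorityE !largeE natr_cardsDS //; lra.
Qed.

(* Otherwise every component is small; as closed sets of intermediate size do
   not exist, so are all unions of components, and T is one of them. *)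
Lemma giant_component T :
  majority T -> exists2 x, x \in T & small (T :\: component G T x).
Proof.
move=> majT; apply/exists_inP; apply: contraT => /exists_inPn no_giant.
have n_gt0 : 0 < n.
  rewrite ltr0n (leq_trans _ (max_card (mem T))) //.
  by move: majT; rewrite /majority; case: #|T|.
pose small_closed S := [/\ S \subset T, closed (inner_edge G T) S & small S].
have [_ _] : small_closed (\bigcup_(x in T) component G T x).
  apply: big_ind => [|S1 S2 [sub1 cl1 small1] [sub2 cl2 small2]|x xT].
  - split; first exact: sub0set.
      by move=> u v _; rewrite !inE.
    by rewrite /small cards0 mulr_gt0.
  - have sub : S1 :|: S2 \subset T by rewrite subUset sub1.
    have cl := closed_setU cl1 cl2; split=> //.
    have /orP[//|] := closed_small_or_cosmall majT sub cl.
    have le12 : #|S1 :|: S2|%:R <= #|S1|%:R + #|S2|%:R :> R.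
      by rewrite -natrD ler_nat leq_card_setU.
    move: delta_n_ge0 delta_n_le majT small1 small2.
    by rewrite majorityE /small natr_cardsDS //; lra.
  - have sub := component_sub G xT; have cl := @component_closed _ G T x.
    split=> //; have /orP[//|] := closed_small_or_cosmall majT sub cl.
    by rewrite (negPf (no_giant x xT)).
have -> : \bigcup_(x in T) component G T x = T.
  apply/eqP; rewrite eqEsubset; apply/andP; split.
    by apply/bigcupsP => x; apply: component_sub.
  by apply/subsetP => x xT; apply/bigcupP; exists x => //; apply: mem_component.
by move: delta_n_ge0 delta_n_le majT; rewrite majorityE /small; lra.
Qed.

Lemma large_component T :
  majority T -> exists2 x, x \in T & large (component G T x).
Proof.
move=> majT; have [x xT smallTK] := giant_component majT; exists x => //.
move: delta_n_ge0 delta_n_le majT smallTK.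
by rewrite majorityE largeE /small natr_cardsDS ?component_sub //; lra.
Qed.

Lemma large_component_unique T x y : x \in T -> y \in T ->
  large (component G T x) -> large (component G T y) ->
  component G T x = component G T y.
Proof.
move=> xT yT bigx; rewrite largeE => bigy.
have [/existsP[z /andP[/component_eq <- /component_eq <-]] // | disj] :=
  boolP [exists z, (z \in component G T x) && (z \in component G T y)].
exfalso; have sub : component G T y \subset T :\: component G T x.
  rewrite subsetD component_sub // disjoint_sym disjoint_subset.
  apply/subsetP => z zx; rewrite inE; apply: contra disj => zy.
  by apply/existsP; exists z; rewrite zx.
have := small_closed_compl (component_sub G xT) (component_closed x) bigx.
move/(sub_small sub); rewrite /small => smally.
have n_gt0 : 0 < n by rewrite ltr0n; apply/card_gt0P; exists x.
by move: delta_n_ge0 delta_n_le; lra.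
Qed.

(* W := T1 :&: T2 is small if it misses a large component of G[T1], and all its
   outer neighbors lie outside T1 :|: T2, where fewer than |W| vertices are left:
   this contradicts expansion. *)
Lemma agree_meets_large_component T1 T2 x : agree G T1 T2 ->
  majority T1 -> majority T2 -> x \in T1 -> large (component G T1 x) ->
  exists2 y, y \in component G T1 x & y \in T2.
Proof.
move=> agr maj1 maj2 xT bigK; apply/exists_inP; apply: contraT => /exists_inPn K2.
set W := T1 :&: T2.
have NW : outer_nbrs G W \subset ~: (T1 :|: T2).
  apply/subsetP => v; rewrite !inE => /andP[vW /exists_inP[w]].
  rewrite inE => /andP[w1 w2] /(agr _ _ w1 w2) v12.
  by move: vW; rewrite v12 andbb orbb.
have smallW : small W.
  have := small_closed_compl (component_sub G xT) (component_closed x) bigK.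
  apply: sub_small; apply/subsetP => w; rewrite in_setI in_setD => /andP[-> w2].
  by rewrite andbT; apply: contraL w2 => /K2.
have ltNW : (#|~: (T1 :|: T2)| < #|W|)%N.
  have := cardsC (T1 :|: T2); have := subset_leq_card (subsetIl T1 T2).
  by move: maj1 maj2; rewrite /majority cardsU -/W; lia.
have : (#|W| < #|outer_nbrs G W|)%N.
  apply: expG.1; first by rewrite -card_gt0 (leq_ltn_trans _ ltNW).
  by move: delta_n_ge0 smallW; rewrite /small -mulrA -/n; lra.
by rewrite ltnNge (leq_trans (subset_leq_card NW) (ltnW ltNW)).
Qed.

Lemma agree_large_component_eq T1 T2 x1 x2 : agree G T1 T2 ->
  majority T1 -> majority T2 -> x1 \in T1 -> x2 \in T2 ->
  large (component G T1 x1) -> large (component G T2 x2) ->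
  component G T1 x1 = component G T2 x2.
Proof.
move=> agr maj1 maj2 x1T x2T big1 big2.
have [y yK y2] := agree_meets_large_component agr maj1 maj2 x1T big1.
have y1 := subsetP (component_sub G x1T) y yK.
move: big1; rewrite -(component_eq yK) (agree_component_eq agr y1 y2) => big1.
exact: large_component_unique.
Qed.

Lemma large_component_identifies T B x :
  bipartition T B -> x \in T -> large (component G T x) ->
  [/\ component G T x \subset T, outer_nbrs G (component G T x) \subset B
    & (1 - delta) * n < #|component G T x :|: outer_nbrs G (component G T x)|%:R].
Proof.
move=> bip xT bigK; have KT := component_sub G xT; split=> //.
  rewrite (bipartition_setC bip); apply: outer_nbrs_closed KT _.
  exact: component_closed.
have := small_nonneighbors bigK; rewrite /small; set S := _ :|: _.
have -> : n = #|S|%:R + #|~: S|%:R by rewrite -natrD cardsC.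
lra.
Qed.

End Expander.

(** * The identification procedure *)

Section Procedure.
Variables (V : finType) (G : sgraph V).
Implicit Types (r : report_profile G) (T B : {set V}).

Definition truthful (x : status) : bool := if x is Truthful then true else false.

Definition consistentb r T : bool :=
  [forall u in T, forall v : nbr G u, truthful (r u v) == (sval v \in T)].

Lemma consistent_consistentb r T B :
  bipartition T B -> consistent r T B -> consistentb r T.
Proof.
move=> bip con; apply/forall_inP => u uT; apply/forallP => v.
have [conT conB] := con u uT v; have [/conT -> // | vT] := boolP (sval v \in T).
by rewrite conB // (bipartition_setC bip) inE.
Qed.

Lemma consistentb_agree r T1 T2 :
  consistentb r T1 -> consistentb r T2 -> agree G T1 T2.
Proof.
move=> con1 con2 u v u1 u2 uv.
have /forallP/(_ (exist _ v uv))/eqP <- := forall_inP con1 u u1.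
by have /forallP/(_ (exist _ v uv))/eqP <- := forall_inP con2 u u2.
Qed.

Definition plausible r (p : {set V} * V) : bool :=
  [&& consistentb r p.1, majority p.1, p.2 \in p.1 & large (component G p.1 p.2)].

Definition plausible_component r : {set V} :=
  if [pick p | plausible r p] is Some p then component G p.1 p.2 else set0.

Lemma plausible_component_eq (R : realFieldType) (delta : R) r p :
  0 < delta -> delta < 1 / 8 -> good_expander delta G ->
  plausible r p -> plausible_component r = component G p.1 p.2.
Proof.
move=> delta_gt0 delta_lt expG pl; rewrite /plausible_component.
case: pickP => [p' | /(_ p)]; last by rewrite pl.
case/and4P: pl => con maj pT big /and4P[con' maj' pT' big'].
have agr := consistentb_agree con' con.
exact: (agree_large_component_eq delta_gt0 delta_lt expG agr).
Qed.

End Procedure.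

Local Close Scope ring_scope.

(** * Depth-first search *)

Section DepthFirstSearch.
Variables (V : finType) (succ : V -> seq V).
Implicit Types (u v : V) (s o : seq V).

(* [dfs s0 s o]: from the stack s0 the search can reach the stack s, having visited
   the vertices of o, the last one first.  All successors are pushed, visited or
   not, and vertices already visited are discarded when they are popped. *)
Inductive dfs s0 : seq V -> seq V -> Prop :=
| dfs_start : dfs s0 s0 [::]
| dfs_skip u s o : dfs s0 (u :: s) o -> u \in o -> dfs s0 s o
| dfs_visit u s o :
    dfs s0 (u :: s) o -> u \notin o -> dfs s0 (rev (succ u) ++ s) (u :: o).

Lemma dfs_uniq s0 s o : dfs s0 s o -> uniq o.
Proof. by elim=> //= u {}s {}o _ -> ->. Qed.

Definition sink_component (K : {set V}) : Prop :=
  {in K, forall x, connect (grel succ) x =i K}.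

Variable K : {set V}.
Hypothesis sinkK : sink_component K.

Definition exploring o s : Prop :=
  [/\ o ++ s != [::], {subset o ++ s <= K}
    & forall u v, u \in o -> v \in succ u -> v \in o ++ s].

Lemma exploring_skip u s o : exploring o (u :: s) -> u \in o -> exploring o s.
Proof.
move=> [_ subK clo] uo.
have eq_mem v : (v \in o ++ u :: s) = (v \in o ++ s).
  by rewrite !mem_cat inE; case: eqP => [-> | _]; rewrite ?uo.
split=> [|v|v w vo vw]; first by case: (o) uo.
- by rewrite -eq_mem; apply: subK.
- by rewrite -eq_mem; apply: clo vw.
Qed.

Lemma exploring_visit u s o :
  exploring o (u :: s) -> exploring (u :: o) (rev (succ u) ++ s).
Proof.
move=> [_ subK clo]; have uK : u \in K by rewrite subK // mem_cat mem_head orbT.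
have memE v :
    v \in (u :: o) ++ rev (succ u) ++ s = (v \in o ++ u :: s) || (v \in succ u).
  by rewrite !(mem_cat, inE) mem_rev; do !case: (_ \in _); rewrite ?orbT.
split=> // [v|v w]; rewrite memE.
  case/orP=> [/subK // | vu]; rewrite -(sinkK uK); exact: connect1.
rewrite inE => /orP[/eqP -> -> | vo /(clo _ _ vo) ->] //; exact: orbT.
Qed.

Lemma exploring_exhausted o : exploring o [::] -> o =i K.
Proof.
move=> []; rewrite cats0 => o_neq0 subK clo.
have [x xo] : exists x, x \in o.
  by case: (o) o_neq0 => // x o' _; exists x; apply: mem_head.
move=> v; apply/idP/idP => [/subK // | ].
rewrite -(sinkK (subK x xo)) => /connectP[p].
elim: p x xo => [|y p IH] x xo /= => [_ -> // | /andP[xy]].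
by apply: IH; apply: clo xo xy.
Qed.

Lemma dfs_sink x o : x \in K -> dfs [:: x] [::] o -> o =i K.
Proof.
move=> xK dfs_o; apply: exploring_exhausted.
elim: dfs_o => [|u s {}o _|u s {}o _]; last by move=> + _; apply: exploring_visit.
  by split=> // v; rewrite inE => /eqP ->.
exact: exploring_skip.
Qed.

(* Until the search enters K, every vertex of K waits on the stack; from then on
   only vertices of K are visited until K is exhausted. *)
Inductive phase s o : Prop :=
| Unentered of {subset K <= s} & {in o, forall v, v \notin K}
| Entered top base inside before of
    s = top ++ base & o = inside ++ before &
    exploring inside top & {in before, forall v, v \notin K}
| Exhausted after inside before of o = after ++ inside ++ before & inside =i K.

Lemma phase_skip u s o : phase (u :: s) o -> u \in o -> phase s o.
Proof.
case=> [Ks oK | [|w top] base inside before /= es eo expl beforeK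
  | after inside before eo insideK] uo.
- apply: Unentered => // v vK; have := Ks v vK; rewrite inE => /orP[/eqP ev | //].
  by have := oK u uo; rewrite -ev vK.
- by apply: (@Exhausted _ _ [::] inside before) => //; apply: exploring_exhausted.
- case: es expl => <- -> expl; apply: (Entered erefl eo _ beforeK).
  apply: (exploring_skip expl); move: uo; rewrite eo mem_cat => /orP[// | /beforeK].
  by case: expl => _ -> //; rewrite mem_cat mem_head orbT.
- exact: Exhausted eo insideK.
Qed.

Lemma phase_visit u s o : phase (u :: s) o -> phase (rev (succ u) ++ s) (u :: o).
Proof.
case=> [Ks oK | [|w top] base inside before /= es eo expl beforeK
  | after inside before eo insideK].
- have [uK | uK] := boolP (u \in K).
    apply: (@Entered _ _ (rev (succ u)) s [:: u] o) => //.
    rewrite -[rev _]cats0; apply: exploring_visit; split=> // v.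
    by rewrite inE => /eqP ->.
  apply: Unentered => v; last by rewrite inE => /orP[/eqP -> | /oK].
  move=> vK; have := Ks v vK; rewrite inE mem_cat => /orP[/eqP ev | ->].
    by rewrite -ev vK in uK.
  exact: orbT.
- apply: (@Exhausted _ _ [:: u] inside before); first by rewrite eo.
  exact: exploring_exhausted.
- case: es expl => <- -> expl.
  apply: (Entered _ _ (exploring_visit expl) beforeK); first exact: catA.
  by rewrite eo.
- by apply: (@Exhausted _ _ (u :: after) inside before) => //; rewrite eo.
Qed.

Lemma dfs_phase s0 s o : {subset K <= s0} -> dfs s0 s o -> phase s o.
Proof.
move=> Ks0; elim=> [|u {}s {}o _|u {}s {}o _ + _].
- exact: Unentered.
- exact: phase_skip.
- exact: phase_visit.
Qed.

Lemma dfs_block s0 o : {subset K <= s0} -> K != set0 -> dfs s0 [::] o ->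
  exists after inside before, o = after ++ inside ++ before /\ inside =i K.
Proof.
move=> Ks0 /set0Pn[x xK].
case/(dfs_phase Ks0)=> [Ks | top base inside before | after inside before].
- by have := Ks x xK.
- case: top => // _ eo expl _; exists [::], inside, before.
  by split=> //; apply: exploring_exhausted.
- by exists after, inside, before.
Qed.

Lemma dfs_middle x0 s0 o : {subset K <= s0} -> majority K -> dfs s0 [::] o ->
  #|V|./2 < size o /\ nth x0 (rev o) #|V|./2 \in K.
Proof.
rewrite /majority => Ks0 majK dfs_o.
have K_neq0 : K != set0 by rewrite -card_gt0; lia.
have [after [inside [before [eo insideK]]]] := dfs_block Ks0 K_neq0 dfs_o.
have uo := dfs_uniq dfs_o.
have size_o : size o <= #|V| by rewrite -(card_uniqP uo) max_card.
have size_inside : size inside = #|K|.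
  move: uo; rewrite eo !cat_uniq => /and4P[_ _ uniq_inside _].
  by rewrite -(card_uniqP uniq_inside); apply: eq_card.
move: size_o; rewrite eo !size_cat size_inside => size_o; split; first by lia.
rewrite !rev_cat -catA !nth_cat !size_rev size_inside ifN; last by lia.
rewrite ifT; last by lia.
by rewrite -insideK -mem_rev mem_nth // size_rev size_inside; lia.
Qed.

End DepthFirstSearch.

(** * Cost-aware program logic *)

(* [p] is a stock of time credits: the run of [c] and what is left for the
   continuation [Q] are paid from it. *)
Definition run (c : cmd) (m : memory) (p : nat) (Q : nat -> memory -> Prop) : Prop :=
  exists t m' p', [/\ exec c m t m', t + p' <= p & Q p' m'].

Definition var (a : nat) : expr := Cell a (Lit 0).
Definition assign (a : nat) (e : expr) : cmd := Store a (Lit 0) e.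

(* A stack is kept in an array [a], its height in a variable [h]. *)
Definition push (a h : nat) (e : expr) : cmd :=
  Seq (Store a (var h) e) (assign h (Succ (var h))).
Definition pop (a h x : nat) : cmd :=
  Seq (assign h (Pred (var h))) (assign x (Cell a (var h))).

Section Rules.
Implicit Types (c : cmd) (m : memory) (Q : nat -> memory -> Prop).

Lemma run_weaken c m p0 p (Q0 : memory -> Prop) Q :
  run c m p0 (fun=> Q0) -> p0 <= p ->
  (forall m', Q0 m' -> Q (p - p0) m') -> run c m p Q.
Proof.
move=> [t [m' [p' [exec_c le_p0 Q0m']]]] le_p imp; exists t, m', (p - p0).
by split; [exact: exec_c | lia | exact: imp].
Qed.

Lemma run_skip m p Q : 1 <= p -> Q (p - 1) m -> run Skip m p Q.
Proof.
by move=> le Qm; exists 1, m, (p - 1); split=> //; [exact: exec_skip | lia].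
Qed.

Lemma run_store a i e m p Q : (expr_cost i + expr_cost e).+1 <= p ->
  Q (p - (expr_cost i + expr_cost e).+1) (update m a (eval m i) (eval m e)) ->
  run (Store a i e) m p Q.
Proof.
move=> le Qm; eexists _, _, _; split; [exact: exec_store | | exact: Qm].
by lia.
Qed.

Lemma run_seq c1 c2 m p Q :
  run c1 m p (fun p' m' => run c2 m' p' Q) -> run (Seq c1 c2) m p Q.
Proof.
move=> [t1 [m1 [p1 [exec1 le1 [t2 [m2 [p2 [exec2 le2 Qm2]]]]]]]].
by exists (t1 + t2), m2, p2; split=> //; [apply: exec_seq exec1 exec2 | lia].
Qed.

Lemma run_if b c1 c2 m p Q : test_cost b <= p ->
  run (if holds m b then c1 else c2) m (p - test_cost b) Q ->
  run (If b c1 c2) m p Q.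
Proof.
move=> le [t [m' [p' [exec_branch le' Qm']]]].
by exists (test_cost b + t), m', p'; split=> //; [apply: exec_if | lia].
Qed.

(* Every test costs a credit, so a loop that can pay for its runs terminates. *)
Lemma run_while (I : nat -> memory -> Prop) b c m p Q :
  (forall p' m', I p' m' -> test_cost b <= p' /\
     if holds m' b then run c m' (p' - test_cost b) I
     else Q (p' - test_cost b) m') ->
  I p m -> run (While b c) m p Q.
Proof.
move=> step; have [k] := ubnP p; elim: k p m => // k IH p m lt_p Ipm.
have [le_p] := step p m Ipm; case: ifPn => bm.
  move=> [t1 [m1 [p1 [exec1 le1 Im1]]]].
  have tb : 0 < test_cost b by case: (b).
  have [|t2 [m2 [p2 [exec2 le2 Qm2]]]] := IH p1 m1 _ Im1; first by lia.
  exists (test_cost b + t1 + t2), m2, p2; split=> //; last by lia.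
  exact: exec_while_step exec1 exec2.
move=> Qm; exists (test_cost b), m, (p - test_cost b); split=> //.
  exact: exec_while_stop.
by lia.
Qed.

Lemma run_push a h e m p Q : h != a -> 8 + expr_cost e <= p ->
  Q (p - (8 + expr_cost e))
    (update (update m a (m h 0) (eval m e)) h 0 (m h 0).+1) ->
  run (push a h e) m p Q.
Proof.
move=> /negPf ha le Qm; apply/run_seq/run_store => /=; first by lia.
apply: run_store => /=; first by lia.
have -> : update m a (m h 0) (eval m e) h 0 = m h 0 by rewrite /update ha.
by rewrite -subnDA [_ + _](_ : _ = 8 + expr_cost e) //; lia.
Qed.

Lemma run_pop a h x m p Q : a != h -> 10 <= p ->
  Q (p - 10) (update (update m h 0 (m h 0).-1) x 0 (m a (m h 0).-1)) ->
  run (pop a h x) m p Q.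
Proof.
move=> /negPf ah le Qm; apply/run_seq/run_store => /=; first by lia.
apply: run_store => /=; first by lia.
set m' := update m h 0 (m h 0).-1.
have -> : m' a (m' h 0) = m a (m h 0).-1 by rewrite /m' /update ah !eqxx.
by rewrite -subnDA.
Qed.

End Rules.

(** * The search program *)

(* Arrays 0 to 4 are those of [input] and [output]. *)
Local Notation SIZE := 0 (only parsing).
Local Notation OFFSET := 1 (only parsing).
Local Notation TARGET := 2 (only parsing).
Local Notation REPORT := 3 (only parsing).
Local Notation MARK := 4 (only parsing).
Local Notation HEIGHT := 5 (only parsing).
Local Notation STACK := 6 (only parsing).
Local Notation COUNT := 7 (only parsing).
Local Notation ORDER := 8 (only parsing).
Local Notation CUR := 9 (only parsing).
Local Notation POS := 10 (only parsing).
Local Notation HALF := 11 (only parsing).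
Local Notation REST := 12 (only parsing).

Definition scan (body : cmd) : cmd :=
  Seq (assign POS (Cell OFFSET (var CUR)))
    (While (Lt (var POS) (Cell OFFSET (Succ (var CUR))))
       (Seq body (assign POS (Succ (var POS))))).

Definition push_if_trusted : cmd :=
  If (Eq (Cell REPORT (var POS)) (Lit (status_code Truthful)))
    (push STACK HEIGHT (Cell TARGET (var POS))) Skip.

Definition visit (g : nat) : cmd :=
  Seq (Store MARK (var CUR) (Lit g))
  (Seq (push ORDER COUNT (var CUR)) (scan push_if_trusted)).

(* The tag [g] differs from one search to the next, so that the marks left by the
   first search need not be erased. *)
Definition search (g : nat) : cmd :=
  While (Lt (Lit 0) (var HEIGHT))
    (Seq (pop STACK HEIGHT CUR)
      (If (Eq (Cell MARK (var CUR)) (Lit g)) Skip (visit g))).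

Definition mark_target_corrupt : cmd :=
  If (Eq (Cell MARK (Cell TARGET (var POS))) (Lit (status_code Truthful))) Skip
    (Store MARK (Cell TARGET (var POS)) (Lit (status_code Corrupt))).

Definition mark_neighbors : cmd :=
  While (Lt (Lit 0) (var COUNT))
    (Seq (pop ORDER COUNT CUR) (scan mark_target_corrupt)).

Definition push_all : cmd :=
  While (Lt (var HEIGHT) (Cell SIZE (Lit 0))) (push STACK HEIGHT (var HEIGHT)).

Definition halve_size : cmd :=
  Seq (assign HALF (Lit 0))
  (Seq (assign REST (Cell SIZE (Lit 0)))
    (While (Lt (Lit 1) (var REST))
       (Seq (assign REST (Pred (Pred (var REST))))
          (assign HALF (Succ (var HALF)))))).

Definition restart_from_middle : cmd :=
  Seq halve_size
  (Seq (Store STACK (Lit 0) (Cell ORDER (var HALF)))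
  (Seq (assign HEIGHT (Lit 1)) (assign COUNT (Lit 0)))).

(* The first search may use any tag other than 0 and the codes of the statuses. *)
Definition identify_majority : cmd :=
  Seq push_all
  (Seq (search 3)
  (Seq restart_from_middle
  (Seq (search (status_code Truthful)) mark_neighbors))).

Section Stacks.
Variable V : finType.
Implicit Types (u v x : V) (s : seq V) (f : nat -> nat) (m : memory).

Definition rank v : nat := enum_rank v.

Lemma rank_inj : injective rank.
Proof. by move=> u v /val_inj /enum_rank_inj. Qed.

Fixpoint stores_stack f s : Prop :=
  if s is v :: s' then f (size s') = rank v /\ stores_stack f s' else True.

Definition stack_at m a h s : Prop := m h 0 = size s /\ stores_stack (m a) s.

Lemma eq_stores_stack f f' s : (forall i, i < size s -> f' i = f i) ->
  stores_stack f s -> stores_stack f' s.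
Proof.
elim: s => //= v s IH eq_f [fv fs]; split; first by rewrite eq_f.
by apply: IH fs => i lt_i; apply: eq_f; apply: ltnW.
Qed.

Lemma stores_stack_nth x f s i :
  stores_stack f s -> i < size s -> f i = rank (nth x (rev s) i).
Proof.
elim: s => //= v s IH [fv fs]; rewrite ltnS leq_eqVlt rev_cons nth_rcons size_rev.
by case: ltngtP => // [lt_i _ | ->] //; apply: IH.
Qed.

Lemma stack_at_push m a h s v : h != a -> stack_at m a h s ->
  stack_at (update (update m a (m h 0) (rank v)) h 0 (m h 0).+1) a h (v :: s).
Proof.
rewrite eq_sym => /negPf ah [hs stored]; split; first by rewrite /update !eqxx /= hs.
split; first by rewrite /update ah !eqxx /= hs eqxx.
apply: eq_stores_stack stored => i lt_i.
by rewrite /update ah eqxx /= hs ltn_eqF.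
Qed.

End Stacks.

Lemma nth_flatten_index (T : Type) (x : T) (ss : seq (seq T)) i j :
  j < size (nth [::] ss i) ->
  nth x (flatten ss) (flatten_index (shape ss) i j) = nth x (nth [::] ss i) j.
Proof.
move=> lt_j; have lt_shape : j < nth 0 (shape ss) i.
  have [lt_i | ge_i] := ltnP i (size ss); first by rewrite (nth_map [::]).
  by rewrite nth_default in lt_j.
by rewrite nth_flatten flatten_indexKl ?flatten_indexKr.
Qed.

Section Machine.
Variables (V : finType) (G : sgraph V) (r : report_profile G).
Variable adj : forall u : V, seq (nbr G u).
Implicit Types (u v : V) (m : memory) (s o h : seq V).

Definition trusted u (d : seq (nbr G u)) : seq V :=
  [seq sval w | w <- d & truthful (r w)].

Definition trusted_nbrs u : seq V := trusted (adj u).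

Lemma trusted_rcons u (d : seq (nbr G u)) w :
  trusted (rcons d w) =
    if truthful (r w) then rcons (trusted d) (sval w) else trusted d.
Proof. by rewrite /trusted filter_rcons; case: truthful; rewrite ?map_rcons. Qed.

Lemma size_trusted_nbrs u : size (trusted_nbrs u) <= size (adj u).
Proof. by rewrite size_map size_filter count_size. Qed.

Definition offset u : nat := sumn (take (rank u) [seq size (adj w) | w <- enum V]).

Definition stores_graph m : Prop :=
  [/\ m SIZE 0 = #|V|,
      forall u, m OFFSET (rank u) = offset u,
      forall u, m OFFSET (rank u).+1 = offset u + size (adj u)
    & forall u d w d', adj u = d ++ w :: d' ->
        m TARGET (offset u + size d) = rank (sval w) /\
        m REPORT (offset u + size d) = status_code (r w)].

Lemma run_scan u (I : seq (nbr G u) -> memory -> Prop) body b m :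
  (forall d m', I d m' -> stores_graph m' /\ m' CUR 0 = rank u) ->
  (forall d m' k, I d m' -> I d (update m' POS 0 k)) ->
  (forall d w m', I d m' ->
     m' TARGET (m' POS 0) = rank (sval w) ->
     m' REPORT (m' POS 0) = status_code (r w) ->
     run body m' b (fun _ m'' => I (rcons d w) m'' /\ m'' POS 0 = m' POS 0)) ->
  I [::] m ->
  run (scan body) m (12 + (12 + b) * size (adj u)) (fun=> I (adj u)).
Proof.
move=> I_graph I_pos I_body I0; apply/run_seq/run_store => /=; first by lia.
have [[_ off _ _] cur] := I_graph _ _ I0; rewrite cur off.
pose J p m' := exists d d', [/\ adj u = d ++ d', I d m',
  m' POS 0 = offset u + size d & 7 + (12 + b) * size d' <= p].
apply: (run_while (I := J)); last first.
  by exists [::], (adj u); rewrite addn0; split=> //; apply: I_pos.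
move=> p m' [d [d' [adj_u Id pos le_p]]] /=; split; first by lia.
have [[_ _ off_end arcs] cur'] := I_graph _ _ Id; rewrite cur' off_end pos.
case: d' adj_u le_p => [|w d'] adj_u /= le_p.
  by rewrite cats0 in adj_u; rewrite adj_u ltnn.
have [target report] := arcs _ _ _ _ adj_u; rewrite -pos in target report.
rewrite ifT; last by rewrite adj_u size_cat /=; lia.
apply/run_seq/(run_weaken (I_body d w m' Id target report)); first by lia.
move=> m'' [Id' pos']; apply: run_store => /=; first by lia.
exists (rcons d w), d'; split; first by rewrite cat_rcons.
- exact: I_pos.
- by rewrite /update /= pos' pos size_rcons addnS.
- by lia.
Qed.

Definition search_state g (old : V -> nat) s o m : Prop :=
  [/\ stores_graph m, stack_at m STACK HEIGHT s, stack_at m ORDER COUNT o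
    & forall v, m MARK (rank v) = if v \in o then g else old v].

Lemma run_push_if_trusted g old s o u d (w : nbr G u) m :
  search_state g old (rev (trusted d) ++ s) o m -> m CUR 0 = rank u ->
  m TARGET (m POS 0) = rank (sval w) -> m REPORT (m POS 0) = status_code (r w) ->
  run push_if_trusted m 16 (fun _ m' =>
    (search_state g old (rev (trusted (rcons d w)) ++ s) o m' /\ m' CUR 0 = rank u)
    /\ m' POS 0 = m POS 0).
Proof.
move=> [graph stack order marks] cur target report; apply: run_if => //=.
rewrite trusted_rcons report; case: (r w) => /=; last exact: run_skip.
apply: run_push => //=; rewrite target; do 3!split=> //.
by rewrite rev_rcons; apply: stack_at_push.
Qed.

Lemma run_visit g old s o u m :
  search_state g old s o m -> m CUR 0 = rank u ->
  run (visit g) m (26 + 28 * size (adj u))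
    (fun=> search_state g old (rev (trusted_nbrs u) ++ s) (u :: o)).
Proof.
move=> [graph stack order marks] cur.
apply/run_seq/run_store => /=; first by lia.
apply/run_seq/run_push => //=.
set m0 := update m MARK _ _; have cur0 : m0 CUR 0 = rank u by [].
rewrite cur0; set m1 := update _ COUNT _ _.
pose I (d : seq (nbr G u)) m' :=
  search_state g old (rev (trusted d) ++ s) (u :: o) m' /\ m' CUR 0 = rank u.
apply: (run_weaken (@run_scan u I push_if_trusted 16 m1 _ _ _ _)).
- by move=> d m' [[]].
- by move=> d m' k [[graph' stack' order' marks'] cur'].
- by move=> d w m' [state cur'] target report; apply: run_push_if_trusted.
- split=> //; split=> //; first exact: (stack_at_push (m := m0)).
  move=> v; rewrite /m1 /m0 /update /= inE cur (inj_eq (@rank_inj V)) marks.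
  by case: (v == u).
- by lia.
- by move=> m' [].
Qed.

Definition lists_size : nat := \sum_u (size (adj u)).+1.

Lemma leq_card_lists_size : #|V| <= lists_size.
Proof. by rewrite -sum1_card; apply: leq_sum. Qed.

Lemma leq_sum_lists_size o : uniq o -> \sum_(u <- o) (size (adj u)).+1 <= lists_size.
Proof.
by move=> uo; rewrite big_uniq //= /lists_size [leqRHS](bigID (mem o)) leq_addr.
Qed.

Lemma run_search g old s0 m0 : (forall v, old v != g) ->
  search_state g old s0 [::] m0 ->
  run (search g) m0 (4 + 20 * size s0 + 50 * lists_size)
    (fun _ m => exists2 o, dfs trusted_nbrs s0 [::] o & search_state g old [::] o m).
Proof.
move=> fresh state0.
pose unvisited o := \sum_(u | u \notin o) (size (adj u)).+1.
pose I p m := exists s o, [/\ dfs trusted_nbrs s0 s o, search_state g old s o m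
  & 4 + 20 * size s + 50 * unvisited o <= p].
apply: (run_while (I := I)); last first.
  by exists s0, [::]; split=> //; exact: dfs_start.
move=> p m [s [o [dfs_so [graph [height stored] order marks] le_p]]].
split; first by move=> /=; lia.
case: s dfs_so height stored le_p => [|u s] dfs_so /= height stored le_p.
  by rewrite height /=; exists o.
case: stored => top stored; rewrite height /=.
apply/run_seq/run_pop => //; first by lia.
rewrite height /= top; set m1 := update _ CUR _ _.
have cur1 : m1 CUR 0 = rank u by [].
apply: run_if => /=; first by lia.
rewrite cur1 [m1 _ _]marks; have [uo | uo] := boolP (u \in o).
  rewrite eqxx; apply: run_skip; first by lia.
  by exists s, o; split=> //; [exact: dfs_skip uo | move=> /=; lia].
rewrite (negPf (fresh u)).
have state1 : search_state g old s o m1 by [].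
have unvisitedE : unvisited o = (size (adj u)).+1 + unvisited (u :: o).
  rewrite /unvisited (bigD1 u) //=; congr (_ + _); apply: eq_bigl => v.
  by rewrite inE negb_or andbC.
apply: (run_weaken (run_visit state1 cur1)); first by lia.
move=> m2 state2; exists (rev (trusted_nbrs u) ++ s), (u :: o).
split=> //; first exact: dfs_visit.
by have := size_trusted_nbrs u; rewrite size_cat size_rev; lia.
Qed.

Lemma run_push_all g old m0 : search_state g old [::] [::] m0 ->
  run push_all m0 (5 + 15 * #|V|) (fun=> search_state g old (rev (enum V)) [::]).
Proof.
move=> state0.
pose I p m := exists2 k, k <= #|V| /\ 5 + 15 * (#|V| - k) <= p
  & search_state g old (rev (take k (enum V))) [::] m.
apply: (run_while (I := I)); last by exists 0; [lia | rewrite take0].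
move=> p m [k [le_k le_p] [graph stack order marks]]; split; first by move=> /=; lia.
have [card_V _ _ _] := graph; have [height _] := stack.
rewrite size_rev size_takel -?cardE // in height.
rewrite /= height card_V; case: ltnP => [lt_k | ge_k]; last first.
  by have -> : enum V = take k (enum V) by rewrite take_oversize // -cardT.
pose v := enum_val (Ordinal lt_k).
have height_v : eval m (var HEIGHT) = rank v by rewrite /rank enum_valK.
apply: run_push; rewrite ?height_v //=; first by lia.
exists k.+1; first by lia.
rewrite (take_nth v) -?cardE // rev_rcons -(enum_val_nth v (Ordinal lt_k)) -/v.
by split=> //; apply: stack_at_push.
Qed.

Lemma run_halve_size g old s o m0 : search_state g old s o m0 ->
  run halve_size m0 (11 + 15 * #|V|)
    (fun _ m => search_state g old s o m /\ m HALF 0 = #|V|./2).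
Proof.
move=> state0; have [[card_V _ _ _] _ _ _] := state0; rewrite -card_V.
apply/run_seq/run_store => /=; first by lia.
apply/run_seq/run_store => /=; first by lia.
pose I p m := [/\ search_state g old s o m,
  m REST 0 + (m HALF 0).*2 = m0 SIZE 0 & 4 + 15 * m REST 0 <= p].
apply: (run_while (I := I)); last first.
  by split=> //; rewrite /update /= ?addn0 //; lia.
move=> p m [state halved le_p] /=; split; first by lia.
case: ltnP => rest; last by split=> //; lia.
apply/run_seq/run_store => /=; first by lia.
apply: run_store => /=; first by lia.
by split=> //; rewrite /update /=; lia.
Qed.

Lemma run_restart_from_middle x g g' old s o m0 :
  #|V|./2 < size o -> search_state g old s o m0 ->
  run restart_from_middle m0 (22 + 15 * #|V|)
    (fun=> search_state g' (fun v => if v \in o then g else old v)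
       [:: nth x (rev o) #|V|./2] [::]).
Proof.
move=> half_lt state0; apply/run_seq/(run_weaken (run_halve_size state0)).
  by lia.
move=> m [[graph _ [_ stored] marks] half].
apply/run_seq/run_store => /=; first by lia.
apply/run_seq/run_store => /=; first by lia.
apply: run_store => /=; first by lia.
split=> //; split=> //; split=> //.
by rewrite half /update /= (stores_stack_nth x stored).
Qed.

Lemma nth_adjacency (f : forall u, nbr G u -> nat) u d w d' : adj u = d ++ w :: d' ->
  nth 0 [seq f u x | u <- enum V, x <- adj u] (offset u + size d) = f u w.
Proof.
move=> adj_u; set ss := [seq [seq f u w | w <- adj u] | u <- enum V].
have shape_ss : shape ss = [seq size (adj w) | w <- enum V].
  by rewrite /shape -map_comp; apply: eq_map => v /=; rewrite size_map.
have nth_u : nth [::] ss (rank u) = [seq f u w | w <- adj u].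
  by rewrite (nth_map u) ?nth_enum_rank // -cardT ltn_ord.
rewrite /offset -shape_ss -/(flatten_index _ _ _) nth_flatten_index nth_u
  adj_u map_cat.
  by rewrite nth_cat size_map ltnn subnn.
by rewrite size_cat !size_map /=; lia.
Qed.

Lemma input_stores_graph : stores_graph (input r adj).
Proof.
have off i : i <= #|V| ->
    input r adj OFFSET i = sumn (take i [seq size (adj w) | w <- enum V]).
  move=> le_i; rewrite -[LHS]/(nth 0 [seq sumn (take k [seq size (adj w) | w <- enum V])
    | k <- iota 0 #|V|.+1] i).
  by rewrite (nth_map 0) ?size_iota // nth_iota.
have rank_lt u : rank u < size (enum V) by rewrite -cardT ltn_ord.
split=> // [u|u|u d w d' adj_u].
- by rewrite off // ltnW // ltn_ord.
- rewrite off; last exact: ltn_ord.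
  have lt_u : rank u < size [seq size (adj w) | w <- enum V] by rewrite size_map.
  by rewrite (take_nth 0 lt_u) sumn_rcons (nth_map u) // nth_enum_rank.
- by split; [exact: (nth_adjacency (fun u w => rank (sval w)) adj_u)
    | exact: (nth_adjacency (fun u w => status_code (r w)) adj_u)].
Qed.

Lemma input_search_state g : search_state g (fun=> 0) [::] [::] (input r adj).
Proof.
split=> // [|v]; first exact: input_stores_graph.
by rewrite /input /memory_of /= nth_nil.
Qed.

Definition mark_state old s o h m : Prop :=
  [/\ stores_graph m, stack_at m ORDER COUNT s
    & forall v, m MARK (rank v) =
        if v \in o then status_code Truthful
        else if v \in h then status_code Corrupt else old v].

Lemma run_mark_target_corrupt (old : V -> nat) s o h u (w : nbr G u) m :
  (forall v, old v != status_code Truthful) ->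
  mark_state old s o h m -> m CUR 0 = rank u -> m TARGET (m POS 0) = rank (sval w) ->
  run mark_target_corrupt m 11 (fun _ m' =>
    (mark_state old s o (sval w :: h) m' /\ m' CUR 0 = rank u) /\ m' POS 0 = m POS 0).
Proof.
move=> fresh [graph order marks] cur target; apply: run_if => //=.
rewrite target marks; have [wo | wo] := boolP (sval w \in o).
  rewrite eqxx; apply: run_skip => //; do 3!split=> //; move=> v; rewrite marks inE.
  by case: eqP => // ->; rewrite wo.
rewrite ifF; last by case: ifP => // _; apply/negbTE.
apply: run_store => //=; do 3!split=> //; move=> v.
rewrite /update /= target (inj_eq (@rank_inj V)) marks inE.
by case: eqP => // ->; rewrite (negPf wo).
Qed.

Section CompleteLists.
Hypothesis adjP : adjacency_lists adj.

Lemma mem_adj u v : (v \in [seq sval w | w <- adj u]) = G u v.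
Proof.
apply/mapP/idP => [[w _ ->] | uv]; first exact: (valP w).
by exists (exist _ v uv) => //; exact: (adjP u).2.
Qed.

Lemma output_marks (old : V -> nat) o m : (forall v a, old v != status_code a) ->
  (forall v, m MARK (rank v) =
     if v \in o then status_code Truthful
     else if has (G^~ v) o then status_code Corrupt else old v) ->
  output V m Truthful = [set v in o] /\
  output V m Corrupt = outer_nbrs G [set v in o].
Proof.
move=> fresh marks; split; apply/setP => v; rewrite !inE [m _ _]marks.
  by do 2![case: ifP => // _]; exact: negPf (fresh v Truthful).
have -> : has (G^~ v) o = [exists u in [set w in o], G u v].
  by apply/hasP/exists_inP => -[u uo uv]; exists u; rewrite ?inE // in uo *.
by do 2![case: ifP => // _]; exact: negPf (fresh v Corrupt).
Qed.

Lemma run_mark_neighbors old o m0 : (forall v a, old v != status_code a) ->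
  search_state (status_code Truthful) old [::] o m0 ->
  run mark_neighbors m0 (4 + 26 * \sum_(u <- o) (size (adj u)).+1)
    (fun _ m => output V m Truthful = [set v in o] /\
                output V m Corrupt = outer_nbrs G [set v in o]).
Proof.
move=> fresh [graph0 _ order0 marks0].
pose I p m := exists s h, [/\ mark_state old s o h m,
  exists2 o', o = o' ++ s & forall v, (v \in h) = has (G^~ v) o'
  & 4 + 26 * \sum_(u <- s) (size (adj u)).+1 <= p].
apply: (run_while (I := I)); last by exists o, [::]; split=> //; exists [::].
move=> p m [s [h [[graph [count stored] marks] [o' eo mem_h] le_p]]].
split; first by move=> /=; lia.
case: s eo count stored le_p => [|u s] /= eo count stored le_p; rewrite count /=.
  by apply: (output_marks fresh) => v; rewrite marks mem_h eo cats0.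
case: stored => top stored; rewrite big_cons in le_p.
apply/run_seq/run_pop => //; first by lia.
rewrite count /= top; set m1 := update _ CUR _ _.
pose J (d : seq (nbr G u)) m' :=
  mark_state old s o (rev [seq sval w | w <- d] ++ h) m' /\ m' CUR 0 = rank u.
apply: (run_weaken (@run_scan u J mark_target_corrupt 11 m1 _ _ _ _)).
- by move=> d m' [[]].
- by move=> d m' k [[graph' order' marks'] cur'].
- move=> d w m' [state' cur'] target _; rewrite /J map_rcons rev_rcons.
  exact: (run_mark_target_corrupt (fun v => fresh v Truthful)).
- by [].
- by lia.
move=> m' [state' _]; exists s, (rev [seq sval w | w <- adj u] ++ h).
split=> //; last by lia.
exists (rcons o' u) => [|v]; first by rewrite cat_rcons.
by rewrite mem_cat mem_rev mem_adj mem_h has_rcons.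
Qed.

Lemma leq_lists_size : lists_size <= 2 * graph_size G.
Proof.
have degE u : size (adj u) = \sum_(v | G u v) 1.
  have [uniq_adj all_adj] := adjP u.
  rewrite sum1_card -card_sig -(card_uniqP uniq_adj).
  by apply: eq_card => w; rewrite all_adj.
rewrite /lists_size; under eq_bigr do rewrite -addn1 degE addnC.
rewrite big_split /= sum1_card pair_big_dep /= mulnDr.
by apply: leq_add; [rewrite leq_pmull | exact: leq_adjacent_pairs].
Qed.

End CompleteLists.
End Machine.

(** * Searching for the giant component *)

Section Majority.
Variables (V : finType) (G : sgraph V) (r : report_profile G).
Variable adj : forall u : V, seq (nbr G u).
Hypothesis adjP : adjacency_lists adj.
Variables (T : {set V}) (x : V).
Hypotheses (conT : consistentb r T) (xT : x \in T).
Let K : {set V} := component G T x.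

Lemma mem_trusted_nbrs u v : u \in T ->
  (v \in trusted_nbrs r adj u) = inner_edge G T u v.
Proof.
move=> uT; have con w := eqP (forallP (forall_inP conT u uT) w).
rewrite /inner_edge /= uT /=; apply/mapP/andP => [[w] | [uv vT]].
  by rewrite mem_filter con => /andP[wT _] ->; split; first exact: (valP w).
exists (exist _ v uv) => //; rewrite mem_filter con vT; exact: (adjP u).2.
Qed.

Lemma component_sink : sink_component (trusted_nbrs r adj) K.
Proof.
have KT u : u \in K -> u \in T by apply/subsetP/component_sub.
move=> y yK v; apply/idP/idP.
  move=> /connectP[p]; elim: p y yK => [|w p IH] y yK /= => [_ -> // | /andP[yw]].
  apply: IH; rewrite mem_trusted_nbrs ?KT // in yw.
  by rewrite /K -(component_closed x yw).
rewrite /K -(component_eq yK) inE; apply: connect_sub => a b ab; apply: connect1.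
by rewrite /= mem_trusted_nbrs //; case/and3P: ab.
Qed.

Lemma run_identify_majority : majority K ->
  run identify_majority (input r adj) (400 * graph_size G)
    (fun _ m => output V m Truthful = K /\ output V m Corrupt = outer_nbrs G K).
Proof.
move=> majK; have [sinkK sizeL] := (component_sink, leq_lists_size adjP).
have leVL := leq_card_lists_size adj.
have V_gt0 : 0 < #|V| by apply/card_gt0P; exists x.
have leVG : #|V| <= graph_size G by rewrite leq_addr.
apply: run_seq; apply: (run_weaken (run_push_all (input_search_state r adj 3))).
  by lia.
move=> m1 state1.
apply: run_seq; apply: (run_weaken (run_search _ state1)) => //.
  by rewrite size_rev -cardT; lia.
move=> m2 [o1 dfs1 state2].
have subK : {subset K <= rev (enum V)} by move=> v _; rewrite mem_rev mem_enum.
have [half_lt mid_in_K] := dfs_middle sinkK x subK majK dfs1.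
have restart := run_restart_from_middle x (status_code Truthful) half_lt state2.
apply: run_seq; apply: (run_weaken restart).
  by rewrite size_rev -cardT; lia.
set old := fun v => _.
have fresh v a : old v != status_code a by rewrite /old; case: a; case: ifP.
move=> m3 state3.
apply: run_seq; apply: (run_weaken (run_search (fresh^~ Truthful) state3)).
  by rewrite size_rev -cardT [size [:: _]]/=; lia.
move=> m4 [o2 dfs2 state4]; have o2K := dfs_sink sinkK mid_in_K dfs2.
apply: (run_weaken (run_mark_neighbors adjP fresh state4)).
  have := leq_sum_lists_size adj (dfs_uniq dfs2).
  by rewrite size_rev -cardT [size [:: _]]/=; lia.
by move=> m5; have -> : [set v in o2] = K by apply/setP => v; rewrite inE o2K.
Qed.

End Majority.

Local Open Scope ring_scope.

Theorem theorem1p1 (R : realFieldType) (delta : R)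
    (delta_gt0 : 0 < delta) (delta_lt : delta < 1 / 8) :
  (forall (V : finType) (G : sgraph V), good_expander delta G ->
     exists procedure : report_profile G -> {set V} * {set V},
       (forall r, (procedure r).1 :&: (procedure r).2 = set0) /\
       forall T B : {set V}, bipartition T B -> (#|B| < #|T|)%N ->
       forall r : report_profile G, consistent r T B ->
         [/\ (procedure r).1 \subset T,
             (procedure r).2 \subset B
           & (1 - delta) * #|V|%:R
               < #|(procedure r).1 :|: (procedure r).2|%:R])
  /\
  (exists (algorithm : cmd) (c : nat),
     forall (V : finType) (G : sgraph V), good_expander delta G ->
     forall T B : {set V}, bipartition T B ->
       (1 / 2 + delta) * #|V|%:R < #|T|%:R ->
     forall r : report_profile G, consistent r T B ->
     forall adj : (forall u : V, seq (nbr G u)), adjacency_lists adj ->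
     exists (t : nat) (m : memory),
       [/\ exec algorithm (input r adj) t m,
           (t <= c * graph_size G)%N,
           output V m Truthful \subset T,
           output V m Corrupt \subset B
         & (1 - delta) * #|V|%:R
             < #|output V m Truthful :|: output V m Corrupt|%:R]).
Proof.
split=> [V G expG | ].
  pose K r := plausible_component (G := G) r.
  exists (fun r => (K r, outer_nbrs G (K r))).
  split=> [r | T B bip maj r con]; first exact: disjoint_outer_nbrs.
  have conT := consistent_consistentb bip con.
  rewrite -(bipartition_majority bip) in maj.
  have [x xT bigK] := large_component delta_gt0 delta_lt expG maj.
  have -> : K r = component G T x.
    apply: (plausible_component_eq (p := (T, x)) delta_gt0 delta_lt expG).
    exact/and4P.
  exact: large_component_identifies.
exists identify_majority, 400%N => V G expG T B bip bigT r con adj adjP.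
have dn_ge0 : 0 <= delta * #|V|%:R by rewrite mulr_ge0 ?ler0n // ltW.
have majT : majority T by rewrite (majorityE R); lra.
have [x xT smallTK] := giant_component delta_gt0 delta_lt expG majT.
have majK : majority (component G T x).
  by move: smallTK; rewrite (majorityE R) /small natr_cardsDS ?component_sub //; lra.
have conT := consistent_consistentb bip con.
have [t [m [p [exec_t le_t [outT outB]]]]] := run_identify_majority adjP conT xT majK.
have [subT subB cover] := large_component_identifies expG bip xT (majority_large majK).
by exists t, m; rewrite outT outB (leq_trans (leq_addr p t) le_t).
Qed.
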